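(* Let $X_V=(X_V(t))_{t\in\mathbb Z}$ be a stationary stochastic process and let $G=(V,E)$ be a mixed graph. Suppose that $X_V$ satisfies the following condition: for all subsets $A,B,C$ of $V$, all $k\in\mathbb N$ and all $t\in\mathbb Z$, the $\sigma$-algebras $\mathscr X_A(t)$ and $\mathscr X_B(t)$ are measurably separable conditionally on $\mathscr X_{A\cap B}(t)\vee\mathscr X_C(t-k)$. Then the block-recursive (BC), local (LC) and pairwise (PC) Granger-causal Markov properties of $X_V$ with respect to $G$ are related by $$\mathrm{(BC)}\ \Rightarrow\ \mathrm{(LC)}\ \Leftrightarrow\ \mathrm{(PC)}.$$ Furthermore, if $X_V$ additionally satisfies the composition property that, for all disjoint $A,B\subseteq V$, $$X_A\nrightarrow X_B\,[\mathscr X_V]\iff X_A\nrightarrow X_b\,[\mathscr X_V]\ \text{ for all } b\in B,$$ then the three properties (BC), (LC) and (PC) are equivalent.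
   Context: Setting. $V$ is a finite set and $X_V=(X_V(t))_{t\in\mathbb Z}$, $X_V(t)=(X_v(t))_{v\in V}\in\mathbb R^V$, is a stationary stochastic process on a probability space $(\Omega,\mathscr F,\mathbb P)$. For $A\subseteq V$, $X_A$ is the subprocess with components $X_a$, $a\in A$; $\mathscr X_A(t)$ is the $\sigma$-algebra generated by $(X_A(s))_{s\le t}$; $\mathscr X_A=(\mathscr X_A(t))_{t\in\mathbb Z}$. Singletons are written without braces. $\mathbb N=\{1,2,\dots\}$. $\mathscr F_1\vee\mathscr F_2$ is the smallest $\sigma$-algebra containing $\mathscr F_1\cup\mathscr F_2$. $\mathscr F_1\perp\!\!\!\perp\mathscr F_2\mid\mathscr F_3$ means conditional independence of $\mathscr F_1$ and $\mathscr F_2$ given $\mathscr F_3$. Measurable separability. $\overline{\mathscr H}$ is the $\sigma$-algebra generated by $\mathscr H$ and the $\mathbb P$-null sets of $\mathscr F$. $\mathscr F_2$ and $\mathscr F_3$ are measurably separable conditionally on $\mathscr F_4$ if $\overline{\mathscr F_2\vee\mathscr F_4}\cap\overline{\mathscr F_3\vee\mathscr F_4}=\overline{\mathscr F_4}$. Granger noncausality. For disjoint $A,B\subseteq V$: - $X_A\nrightarrow X_B\,[\mathscr X_V]$ ($X_A$ is strongly Granger-noncausal for $X_B$ with respect to $\mathscr X_V$) if $\mathscr X_B(t+1)\perp\!\!\!\perp\mathscr X_A(t)\mid\mathscr X_{V\setminus A}(t)$ for all $t\in\mathbb Z$; - $X_A\nsim X_B\,[\mathscr X_V]$ (contemporaneous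 conditional independence with respect to $\mathscr X_V$) if $\mathscr X_A(t+1)\perp\!\!\!\perp\mathscr X_B(t+1)\mid\mathscr X_V(t)\vee\mathscr X_{V\setminus(A\cup B)}(t+1)$ for all $t\in\mathbb Z$. Graphs. A mixed graph $G=(V,E)$ has directed edges $a\to b$ and undirected edges $a - b$ between distinct vertices (several edges of different type or direction between the same two vertices are allowed; no self-loops). $\mathrm{pa}(a)=\{v: v\to a\in E\}$, $\mathrm{ne}(a)=\{v: v - a\in E\}$, $\mathrm{pa}(A)=\bigcup_{a\in A}\mathrm{pa}(a)\setminus A$, $\mathrm{ne}(A)=\bigcup_{a\in A}\mathrm{ne}(a)\setminus A$. Markov properties of $X_V$ with respect to $G$: - (PC): for all $a\ne b$ in $V$: (i) $a\to b\notin E\Rightarrow X_a\nrightarrow X_b\,[\mathscr X_V]$; (ii) $a - b\notin E\Rightarrow X_a\nsim X_b\,[\mathscr X_V]$. - (LC): for all $a\in V$: (i) $X_{V\setminus(\mathrm{pa}(a)\cup\{a\})}\nrightarrow X_a\,[\mathscr X_V]$; (ii) $X_{V\setminus(\mathrm{ne}(a)\cup\{a\})}\nsim X_a\,[\mathscr X_V]$. - (BC): for all $A\subseteq V$: (i) $X_{V\setminus(\mathrm{pa}(A)\cup A)}\nrightarrow X_A\,[\mathscr X_V]$; (ii) $X_{V\setminus(\mathrm{ne}(A)\cup A)}\nsim X_A\,[\mathscr X_V]$. *)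

(* Defs.v *)
From HB Require Import structures.
From mathcomp Require Import all_boot all_order all_algebra.
From mathcomp Require Import all_classical all_reals all_analysis.

Set Implicit Arguments.
Unset Strict Implicit.
Unset Printing Implicit Defensive.

Import Order.TTheory GRing.Theory Num.Theory.

Local Open Scope classical_set_scope.
Local Open Scope ring_scope.

(* Sub-sigma-algebras of the ambient sigma-algebra of [Omega] are represented
   by their sets of events, of type [set_system Omega]; [<<s H >>] is the
   sigma-algebra generated by [H]. *)

Definition join_sigma (T : Type) (F1 F2 : set_system T) : set_system T :=
  <<s F1 `|` F2 >>.

Section ConditionalIndependence.
Context {d : measure_display} {Omega : measurableType d} {R : realType}.
Variable P : probability Omega R.

(* [Y] is a version of the conditional expectation E[Z | F]. *)
Definition cond_exp_version (F : set_system Omega) (Z Y : Omega -> R) : Prop :=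
  [/\ preimage_set_system setT Y measurable `<=` F,
      P.-integrable setT (EFin \o Y)
    & forall C : set Omega, F C ->
        (\int[P]_(w in C) (Y w)%:E = \int[P]_(w in C) (Z w)%:E)%E].

(* [Y] is a version of the conditional probability P(E | F). *)
Definition cond_prob_version (F : set_system Omega) (E : set Omega)
    (Y : Omega -> R) : Prop :=
  cond_exp_version F (\1_E) Y.

(* P(E1 `&` E2 | F3) = P(E1 | F3) P(E2 | F3) almost surely, for all E1 in F1
   and E2 in F2; versions being unique up to null sets, the choice of versions
   is immaterial. *)
Definition cond_indep (F1 F2 F3 : set_system Omega) : Prop :=
  forall E1 E2 : set Omega, F1 E1 -> F2 E2 ->
  exists Y1 Y2 Y12 : Omega -> R,
    [/\ cond_prob_version F3 E1 Y1,
        cond_prob_version F3 E2 Y2,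
        cond_prob_version F3 (E1 `&` E2) Y12
      & {ae P, forall w, Y12 w = Y1 w * Y2 w}].

Definition completion (H : set_system Omega) : set_system Omega :=
  <<s H `|` [set N | measurable N /\ P N = 0%E] >>.

Definition measurably_separable (F2 F3 F4 : set_system Omega) : Prop :=
  completion (join_sigma F2 F4) `&` completion (join_sigma F3 F4)
  = completion F4.

End ConditionalIndependence.

Section Process.
Context {d : measure_display} {Omega : measurableType d} {R : realType}.
Context {P : probability Omega R} {V : finType}.
Variable X : int -> V -> {RV P >-> R}.

(* Strict stationarity: the finite-dimensional distributions of the real random
   variables [X t v], indexed by pairs (t, v), are invariant under shifts of
   time. *)
Definition stationary : Prop :=
  forall (n : nat) (s : n.-tuple (int * V)) (h : int)
         (D : set (n.-tuple R)), measurable D ->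
    P [set w | D [tuple X (tnth s i).1 (tnth s i).2 w | i < n]]
    = P [set w | D [tuple X ((tnth s i).1 + h) (tnth s i).2 w | i < n]].

Definition hist (A : {set V}) (t : int) : set_system Omega :=
  <<s [set E | exists s a, [/\ s <= t, a \in A
                & preimage_set_system setT (X s a) measurable E]] >>.

Definition noncausal (A B : {set V}) : Prop :=
  forall t : int,
    cond_indep P (hist B (t + 1)) (hist A t) (hist (~: A) t).

Definition contemp_indep (A B : {set V}) : Prop :=
  forall t : int,
    cond_indep P (hist A (t + 1)) (hist B (t + 1))
      (join_sigma (hist [set: V]%SET t) (hist (~: (A :|: B)) (t + 1))).

Definition separability_condition : Prop :=
  forall (A B C : {set V}) (k : nat) (t : int), (0 < k)%N ->
    measurably_separable P (hist A t) (hist B t)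
      (join_sigma (hist (A :&: B) t) (hist C (t - k%:Z))).

Definition composition_property : Prop :=
  forall A B : {set V}, [disjoint A & B]%B ->
    (noncausal A B <-> forall b, b \in B -> noncausal A [set b]%SET).

End Process.

Record mixed_graph (V : finType) := MixedGraph {
  dedge : rel V;
  uedge : rel V;
  dedge_irr : irreflexive dedge;
  uedge_irr : irreflexive uedge;
  uedge_sym : symmetric uedge }.

Section Graph.
Context {V : finType}.
Variable G : mixed_graph V.

Definition pa (a : V) : {set V} := [set v | dedge G v a]%SET.
Definition ne (a : V) : {set V} := [set v | uedge G v a]%SET.
Definition paS (A : {set V}) : {set V} := ((\bigcup_(a in A) pa a) :\: A)%SET.
Definition neS (A : {set V}) : {set V} := ((\bigcup_(a in A) ne a) :\: A)%SET.

End Graph.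

Section MarkovProperties.
Context {d : measure_display} {Omega : measurableType d} {R : realType}.
Context {P : probability Omega R} {V : finType}.
Variables (X : int -> V -> {RV P >-> R}) (G : mixed_graph V).

Definition PC : Prop :=
  forall a b : V, a != b ->
    (~~ dedge G a b -> noncausal X [set a]%SET [set b]%SET) /\
    (~~ uedge G a b -> contemp_indep X [set a]%SET [set b]%SET).

Definition LC : Prop :=
  forall a : V,
    noncausal X (~: (pa G a :|: [set a]%SET)) [set a]%SET /\
    contemp_indep X (~: (ne G a :|: [set a]%SET)) [set a]%SET.

Definition BC : Prop :=
  forall A : {set V},
    noncausal X (~: (paS G A :|: A)) A /\
    contemp_indep X (~: (neS G A :|: A)) A.

End MarkovProperties.

(* Main.v *)
Require Import Defs.
From HB Require Import structures.
From mathcomp Require Import all_boot all_order all_algebra.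
From mathcomp Require Import all_classical all_reals all_analysis.
From mathcomp Require Import measurable_realfun.

(** Each Granger-causal statement is a conditional independence between
sigma-algebras, and the Markov properties are related by the graphoid calculus
of such independences.

From the local to the pairwise property one only moves variables from the
irrelevant side into the conditioning (decomposition and weak union,
[cond_indep_weaken]). For the converse the irrelevant set is built up one vertex
at a time, using the intersection property [cond_indep_intersection]: if [F1] is
independent of [F2] given [F3] and [W], and of [F3] given [F2] and [W], then it is
independent of [F2] and [F3] together given [W]. This property fails in general;
measurable separability is exactly what makes it true, and the assumption on the
histories provides it: the lagged term is trivial for noncausality and is the full
past for contemporaneous independence. Since contemporaneous independence is
symmetric, intersection can be applied on both sides, so the pairwise property
already gives it for any two disjoint sets without an edge between them.
Noncausality is not symmetric, and there the passage from single targets to a set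
of targets is precisely the composition property.

The graphoid rules become short once independence is expressed by one-sided
prediction ([cond_indepP]): [F1] is independent of [F2] given [F3] iff every event
of [F1] has a version of its conditional probability given [F2] and [F3] that is
measurable for [F3] alone. Weak union is then immediate. For intersection, the two
hypotheses give two versions of the same conditional probability, one measurable
for [F3] and [W], the other for [F2] and [W]; they agree almost surely, so both are
measurable for the two completions, hence for the completion of [W], and agree with
the conditional probability given [W].

The characterisation itself rests on three facts: existence of conditional
probabilities, obtained from the Radon-Nikodym theorem on the sub-sigma-algebra,
together with the rule for pulling out what is known ([cond_prob_exists]); their
almost sure uniqueness ([eq_integral_ae]); and a pi-lambda argument
([ge0_version_join]). *)

Set Implicit Arguments.
Unset Strict Implicit.
Unset Printing Implicit Defensive.

Import Order.TTheory GRing.Theory Num.Theory.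

Local Open Scope classical_set_scope.
Local Open Scope ring_scope.

(** * Sub-sigma-algebras *)

Section SubSigmaAlgebra.
Context {d : measure_display} {Omega : measurableType d} {R : realType}.
Implicit Types (F : set_system Omega) (f : Omega -> R).

Definition sub_sigma F : Prop := sigma_algebra setT F /\ F `<=` measurable.

Definition measurable_wrt F f : Prop :=
  preimage_set_system setT f measurable `<=` F.

Lemma sub_sigma_gen F : F `<=` measurable -> sub_sigma <<s F >>.
Proof.
move=> mF; split; first exact: smallest_sigma_algebra.
by apply: smallest_sub => //; exact: sigma_algebra_measurable.
Qed.

(** Measurability in the measurable space generated by [F] is membership in [F],
    so closure properties of [F] can be taken from the theory of measurable sets. *)
Lemma g_sigma_measurableE F (C : set Omega) : sigma_algebra setT F ->
  measurable (C : set (g_sigma_algebraType F)) = F C.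
Proof. by move=> sF; rewrite measurable_g_measurableTypeE. Qed.

(** Functions measurable for a sub-sigma-algebra are measurable functions on
    another measurable space with the same points; their algebra comes for free. *)
Lemma measurable_wrtP F f : sigma_algebra setT F ->
  measurable_wrt F f <-> measurable_fun setT (f : g_sigma_algebraType F -> R).
Proof.
move=> sF; split.
  move=> mf _ B mB; apply: sub_sigma_algebra; apply: mf; exists B => //.
move=> mf _ [B mB <-].
by rewrite -g_sigma_measurableE //; exact: (mf measurableT B mB).
Qed.

Lemma measurable_wrt_fun F f : F `<=` measurable -> measurable_wrt F f ->
  measurable_fun setT f.
Proof. by move=> FM mf _ B mB; apply/FM/mf; exists B. Qed.

End SubSigmaAlgebra.

(** * Restricting a measure to a sub-sigma-algebra *)

Section Trace.
Context {d : measure_display} {Omega : measurableType d} {R : realType}.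
Variables (F : set_system Omega) (sF : sub_sigma F).

(** The same set function on the coarser measurable space carried by [F]. The
    measure axioms hold on it because [F] lies in the ambient sigma-algebra; the
    proof of this is an argument so that canonical inference can find it. *)
Definition trace_measure of sub_sigma F :=
  fun mu : set Omega -> \bar R => mu : set (g_sigma_algebraType F) -> \bar R.

Lemma trace_measurable (C : set (g_sigma_algebraType F)) :
  measurable C -> measurable (C : set Omega).
Proof. by rewrite g_sigma_measurableE; [exact: sF.2|exact: sF.1]. Qed.

Section TraceMeasure.
Variable mu : {measure set Omega -> \bar R}.

Let trace0 : trace_measure sF mu set0 = 0%E. Proof. exact: measure0. Qed.

Let trace_ge0 C : (0 <= trace_measure sF mu C)%E.
Proof. exact: measure_ge0. Qed.

Let trace_sigma_additive : semi_sigma_additive (trace_measure sF mu).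
Proof.
move=> C mC tC mUC; apply: measure_semi_sigma_additive => //.
  by move=> n; exact: trace_measurable.
exact: trace_measurable.
Qed.

HB.instance Definition _ := isMeasure.Build _ _ _ (trace_measure sF mu)
  trace0 trace_ge0 trace_sigma_additive.

(** The trace of [mu] is its image under the identity map from the fine to the
    coarse space, so this is the transfer formula. *)
Lemma trace_ge0_integral (f : g_sigma_algebraType F -> \bar R) (C : set Omega) :
  F C -> measurable_fun setT f ->
  (forall w, 0 <= f w)%E ->
  (\int[trace_measure sF mu]_(w in C) f w = \int[mu]_(w in C) f w)%E.
Proof.
move=> FC mf f0.
have mid : measurable_fun setT (id : Omega -> g_sigma_algebraType F).
  by move=> _ B; rewrite setTI; exact: trace_measurable.
have mC : measurable (C : set (g_sigma_algebraType F)).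
  by rewrite g_sigma_measurableE //; exact: sF.1.
by apply: (ge0_integral_pushforward mid mu) => //; exact: measurable_funTS.
Qed.

Lemma trace_integrable (f : g_sigma_algebraType F -> \bar R) :
  measurable_fun setT f ->
  mu.-integrable setT (f : Omega -> \bar R) -> (trace_measure sF mu).-integrable setT f.
Proof.
move=> mf /integrableP[_ foo]; apply/integrableP; split => //.
rewrite trace_ge0_integral //; last exact: measurableT_comp.
by rewrite -g_sigma_measurableE //; exact: sF.1.
Qed.

Lemma trace_integral (f : g_sigma_algebraType F -> \bar R) (C : set Omega) :
  F C -> measurable_fun setT f ->
  (\int[trace_measure sF mu]_(w in C) f w = \int[mu]_(w in C) f w)%E.
Proof.
move=> FC mf; rewrite [LHS]integralE [RHS](@integralE _ Omega).
rewrite trace_ge0_integral //; last exact: measurable_funepos.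
by rewrite trace_ge0_integral //; exact: measurable_funeneg.
Qed.

End TraceMeasure.

Section TraceFinite.
Variable mu : {finite_measure set Omega -> \bar R}.

Let trace_finite : fin_num_fun (trace_measure sF mu).
Proof. by move=> C /trace_measurable; exact: fin_num_measure. Qed.

HB.instance Definition _ :=
  @Measure_isFinite.Build _ _ _ (trace_measure sF mu) trace_finite.

End TraceFinite.

End Trace.

(** * Conditional probabilities *)

Section ConditionalProbability.
Context {d : measure_display} {Omega : measurableType d} {R : realType}.
Variable P : probability Omega R.
Implicit Types (F : set_system Omega) (E : set Omega) (f : Omega -> R).

(** On the space carried by [F] the hypothesis compares the integrals over all
    measurable sets, which determine an integrable function almost everywhere.
    This is the uniqueness of conditional expectations. *)
Lemma eq_integral_ae F f g : sub_sigma F ->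
  measurable_wrt F f -> measurable_wrt F g ->
  P.-integrable setT (EFin \o f) ->
  (forall C, F C -> (\int[P]_(w in C) (f w)%:E = \int[P]_(w in C) (g w)%:E)%E) ->
  {ae P, forall w, f w = g w}.
Proof.
move=> sF mf mg fi fg.
have mf2 : measurable_fun setT (EFin \o f : g_sigma_algebraType F -> \bar R).
  by apply/measurable_EFinP/measurable_wrtP => //; exact: sF.1.
have mg2 : measurable_fun setT (EFin \o g : g_sigma_algebraType F -> \bar R).
  by apply/measurable_EFinP/measurable_wrtP => //; exact: sF.1.
have : ae_eq (trace_measure sF P) setT (EFin \o f) (EFin \o g).
  apply: integral_ae_eq => //; first exact: trace_integrable.
  move=> C _; rewrite g_sigma_measurableE; last exact: sF.1.
  by move=> FC; rewrite !trace_integral//; exact: fg.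
move=> [N [/(trace_measurable sF) mN QN sN]]; exists N; split => //.
by move=> w /= fgw; apply: sN => /= /(_ I) [].
Qed.

(** The measure [A |-> P (A `&` E)] has density [\1_E] with respect to [P]. *)
Lemma integral_mfrestr E (mE : measurable E) (Eoo : (P E < +oo)%E)
    (f : Omega -> \bar R) (D : set Omega) : measurable D ->
  (forall w, 0 <= f w)%E -> measurable_fun setT f ->
  (\int[mfrestr mE Eoo]_(w in D) f w = \int[P]_(w in D `&` E) f w)%E.
Proof.
move=> mD f0 mf.
pose nu : {finite_measure set Omega -> \bar R} := mfrestr mE Eoo.
have nuP : nu `<< P.
  apply/null_content_dominatesP => A mA PA0.
  by apply/eqP; rewrite -measure_le0 -PA0; exact: measureIl.
rewrite -(@Radon_Nikodym_SigmaFinite.change_of_variables _ _ _ nu P nuP)//;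
  last exact: measurable_funTS.
rewrite [RHS]integral_mkcondr.
apply: ge0_ae_eq_integral => //.
- apply: measurable_funTS; apply: emeasurable_funM => //; apply: measurable_int.
  exact: (Radon_Nikodym_SigmaFinite.f_integrable nuP).
- apply: measurable_funTS.
  by apply/(measurable_restrictT _ _).1 => //; exact: measurable_funTS.
- by move=> w _; rewrite mule_ge0// Radon_Nikodym_SigmaFinite.f_ge0.
- by move=> w _; exact: erestrict_ge0.
have : ae_eq P setT (Radon_Nikodym_SigmaFinite.f nu P) (EFin \o \1_E).
  apply: integral_ae_eq => //.
  - exact: Radon_Nikodym_SigmaFinite.f_integrable.
  - by apply/measurable_EFinP.
  - move=> C _ mC; rewrite -Radon_Nikodym_SigmaFinite.f_integral//.
    by rewrite integral_indic// setIC.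
by apply: filterS => w /= /(_ I) -> _; rewrite epatch_indic.
Qed.

(** [Z] is the Radon-Nikodym density, on the space carried by [F], of
    [A |-> P (A `&` E)] with respect to [P]. The last clause, E[f 1_E | F] =
    f P(E | F) in integrated form, is the change of variables along this density.
    Nonnegativity of [Z] makes products of versions harmless: their integrals
    exist without any boundedness. *)
Lemma cond_prob_exists F E : sub_sigma F -> measurable E ->
  exists Z : Omega -> R,
  [/\ forall w, 0 <= Z w, cond_prob_version P F E Z
    & forall (f : Omega -> R) (D : set Omega),
        (forall w, 0 <= f w) -> measurable_wrt F f -> F D ->
        (\int[P]_(w in D) (f w * Z w)%:E = \int[P]_(w in D `&` E) (f w)%:E)%E].
Proof.
move=> sF mE; have [saF FM] := sF.
have Eoo : (P E < +oo)%E by rewrite ltey_eq fin_num_measure.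
pose mu : {finite_measure set (g_sigma_algebraType F) -> \bar R} :=
  trace_measure sF P.
pose nu : {finite_measure set (g_sigma_algebraType F) -> \bar R} :=
  trace_measure sF (mfrestr mE Eoo).
have numu : nu `<< mu.
  apply/null_content_dominatesP => A /(trace_measurable sF) mA PA0.
  apply/eqP; rewrite -measure_le0 -[leRHS]PA0.
  exact: (@measureIl _ _ _ P A E mA mE).
pose g := Radon_Nikodym_SigmaFinite.f nu mu.
have gfin : forall w, g w \is a fin_num.
  exact: Radon_Nikodym_SigmaFinite.f_fin_num.
have g0 : forall w, (0 <= g w)%E by exact: Radon_Nikodym_SigmaFinite.f_ge0.
pose Z := fine \o g.
have gE : EFin \o Z = g by apply/funext => w /=; rewrite fineK.
have Z0 w : 0 <= Z w by rewrite /Z /= fine_ge0.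
have mg : measurable_fun setT g.
  exact: measurable_int (Radon_Nikodym_SigmaFinite.f_integrable numu).
have mZ : measurable_wrt F Z.
  by apply/measurable_wrtP => //; apply/measurable_EFinP; rewrite gE.
have pull (f : Omega -> R) (D : set Omega) :
    (forall w, 0 <= f w) -> measurable_wrt F f -> F D ->
    (\int[P]_(w in D) (f w * Z w)%:E = \int[P]_(w in D `&` E) (f w)%:E)%E.
  move=> f0 mf FD; have mD := FM _ FD.
  have mf2 : measurable_fun setT (EFin \o f : g_sigma_algebraType F -> \bar R).
    by apply/measurable_EFinP/measurable_wrtP.
  have mf1 : measurable_fun setT (EFin \o f).
    by apply/measurable_EFinP; exact: (measurable_wrt_fun FM mf).
  have f0' w : (0 <= (EFin \o f) w)%E by rewrite lee_fin.
  rewrite -(integral_mfrestr mE Eoo mD f0' mf1).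
  rewrite -(trace_integral sF _ FD mf2).
  have mD2 : measurable (D : set (g_sigma_algebraType F)).
    by rewrite g_sigma_measurableE.
  have := @Radon_Nikodym_SigmaFinite.change_of_variables _ _ _ nu mu numu
    (EFin \o f) D f0' mD2 (measurable_funTS mf2).
  rewrite -/nu => <-.
  rewrite -/g -gE -(trace_integral sF P FD); last first.
    by apply/measurable_EFinP/measurable_wrtP => //;
      apply/measurable_wrtP => //; apply: measurable_funM;
      apply/measurable_wrtP.
  by apply: eq_integral => w _; rewrite /= EFinM.
have pull1 C : F C -> (\int[P]_(w in C) (Z w)%:E = P (E `&` C))%E.
  move=> FC; transitivity (\int[P]_(w in C) ((cst 1%R : Omega -> R) w * Z w)%:E)%E.
    by apply: eq_integral => w _; rewrite mul1r.
  rewrite pull //; last by apply/measurable_wrtP.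
  rewrite (integral_cst P _ 1) ?mul1e ?[_ `&` C]setIC//.
  by apply: measurableI => //; exact: FM.
exists Z; split => //; split => //.
- apply/integrableP; split.
    by apply/measurable_EFinP; exact: (measurable_wrt_fun FM mZ).
  under eq_integral do rewrite /= ger0_norm//.
  rewrite pull1 ?setIT// -g_sigma_measurableE//; exact: measurableT.
- by move=> C FC; rewrite pull1// integral_indic//; exact: FM.
Qed.

End ConditionalProbability.

(** * Joins of sigma-algebras *)

Section JoinAlgebra.
Context {T : Type}.
Implicit Types F G : set_system T.

Lemma join_sigmaS F1 F2 G : sigma_algebra setT G ->
  F1 `<=` G -> F2 `<=` G -> join_sigma F1 F2 `<=` G.
Proof. by move=> sG F1G F2G; apply: smallest_sub => //; rewrite subUset. Qed.

Lemma sub_joinl F1 F2 : F1 `<=` join_sigma F1 F2.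
Proof. by move=> C FC; apply: sub_sigma_algebra; left. Qed.

Lemma sub_joinr F1 F2 : F2 `<=` join_sigma F1 F2.
Proof. by move=> C FC; apply: sub_sigma_algebra; right. Qed.

Lemma join_sigma_mono F1 F2 G1 G2 :
  F1 `<=` G1 -> F2 `<=` G2 -> join_sigma F1 F2 `<=` join_sigma G1 G2.
Proof. by move=> FG1 FG2; apply: sub_sigma_algebra2; exact: setUSS. Qed.

Lemma join_sigmaC F G : join_sigma F G = join_sigma G F.
Proof. by rewrite /join_sigma setUC. Qed.

Lemma join_sigmaA F1 F2 F3 :
  join_sigma F1 (join_sigma F2 F3) = join_sigma (join_sigma F1 F2) F3.
Proof.
have gen (H K : set_system T) : <<s H `|` <<s K >> >> = <<s H `|` K >>.
  apply/seteqP; split; last first.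
    by apply: sub_sigma_algebra2; apply: setUS; exact: sub_sigma_algebra.
  apply: smallest_sub; first exact: smallest_sigma_algebra.
  rewrite subUset; split => [C HC|].
    by apply: sub_sigma_algebra; left.
  by apply: sub_sigma_algebra2; exact: subsetUr.
rewrite /join_sigma gen [RHS](_ : _ = <<s F3 `|` <<s F1 `|` F2 >> >>); last first.
  by rewrite setUC.
by rewrite gen setUA setUC.
Qed.

Lemma join_sigma_absorb F G : sigma_algebra setT G -> F `<=` G -> join_sigma F G = G.
Proof.
by move=> sG FG; rewrite /join_sigma (setUidr FG) sigma_algebra_id.
Qed.

End JoinAlgebra.

(** * Conditional independence as one-sided prediction *)

Section ConditionalIndependence.
Context {d : measure_display} {Omega : measurableType d} {R : realType}.
Variable P : probability Omega R.
Implicit Types (F G : set_system Omega) (E : set Omega) (Y : Omega -> R).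

Lemma sub_sigma_join F1 F2 : sub_sigma F1 -> sub_sigma F2 ->
  sub_sigma (join_sigma F1 F2).
Proof.
by move=> [_ m1] [_ m2]; apply: sub_sigma_gen; rewrite subUset.
Qed.

Lemma sub_sigmaT F : sub_sigma F -> F setT.
Proof. by move=> [sF _]; rewrite -g_sigma_measurableE//; exact: measurableT. Qed.

Lemma sub_sigmaI F (A B : set Omega) : sub_sigma F -> F A -> F B -> F (A `&` B).
Proof.
move=> [sF _]; rewrite -!(g_sigma_measurableE _ sF).
exact: (@measurableI _ (g_sigma_algebraType F)).
Qed.

(** [Y] predicts [E] as well as all of [G] does although it is measurable for
    [F]: when [F `<=` G] are sub-sigma-algebras and [E] is an event, it is a
    version of both P(E | F) and P(E | G). *)
Definition ge0_version F G E Y : Prop :=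
  [/\ forall w, 0 <= Y w, measurable_wrt F Y
    & forall C, G C -> (\int[P]_(w in C) (Y w)%:E = P (E `&` C))%E].

Lemma ge0_version_integrable F G E Y : sub_sigma F -> G setT ->
  measurable E -> ge0_version F G E Y -> P.-integrable setT (EFin \o Y).
Proof.
move=> [sF FM] GT mE [Y0 mY intY]; apply/integrableP; split.
  by apply/measurable_EFinP; exact: (measurable_wrt_fun FM mY).
under eq_integral do rewrite /= ger0_norm//.
by rewrite intY// setIT ltey_eq fin_num_measure.
Qed.

Lemma ge0_version_cond_prob F G E Y : sub_sigma F -> F `<=` G ->
  measurable E -> ge0_version F G E Y -> cond_prob_version P F E Y.
Proof.
move=> sF FG mE vY; have GT : G setT by apply: FG; exact: sub_sigmaT.
have Yi := ge0_version_integrable sF GT mE vY; case: vY => Y0 mY intY.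
split => // C FC; rewrite intY//; last exact: FG.
by rewrite integral_indic//; exact: sF.2.
Qed.

(** The intersections [A `&` D] form a pi-system generating the join, and the
    sets on which the two finite measures [C |-> \int[P]_(w in C) Y w] and
    [C |-> P (E `&` C)] agree form a lambda-system. *)
Lemma ge0_version_join F1 F2 E Y : sub_sigma F1 -> sub_sigma F2 ->
  measurable E -> (forall w, 0 <= Y w) -> measurable_wrt F2 Y ->
  (forall A D, F1 A -> F2 D ->
    (\int[P]_(w in A `&` D) (Y w)%:E = P (E `&` (A `&` D)))%E) ->
  ge0_version F2 (join_sigma F1 F2) E Y.
Proof.
move=> s1 s2 mE Y0 mY YE.
have mY' : measurable_fun setT (EFin \o Y).
  by apply/measurable_EFinP; exact: (measurable_wrt_fun s2.2 mY).
split => // C.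
pose K : set_system Omega := [set A `&` D | A in F1 & D in F2].
have KI : setI_closed K.
  move=> _ _ [A FA [D FD <-]] [A' FA' [D' FD' <-]].
  exists (A `&` A'); first exact: sub_sigmaI.
  by exists (D `&` D'); [exact: sub_sigmaI|rewrite setIACA].
have joinK : join_sigma F1 F2 `<=` <<d K >>.
  rewrite setI_closed_g_dynkin_g_sigma_algebra//.
  apply: join_sigmaS; first exact: smallest_sigma_algebra.
    move=> A FA; apply: sub_sigma_algebra; exists A => //.
    by exists setT; [exact: sub_sigmaT|rewrite setIT].
  move=> D FD; apply: sub_sigma_algebra; exists setT; first exact: sub_sigmaT.
  by exists D => //; rewrite setTI.
pose L : set_system Omega := [set C | measurable C /\
  (\int[P]_(w in C) (Y w)%:E = P (E `&` C))%E].
suff KL : <<d K >> `<=` L by move=> /joinK/KL[].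
have LT : L setT.
  split; first exact: measurableT.
  by have := YE _ _ (sub_sigmaT s1) (sub_sigmaT s2); rewrite setIT.
apply: smallest_sub.
  split => // [B [mB YB]|B tB LB].
  - split; first exact: measurableC.
    have := LT.2; rewrite -(setUv B) ge0_integral_setU//=; last 4 first.
      + exact: measurableC.
      + by rewrite setUv.
      + by move=> w _; rewrite lee_fin.
      + by rewrite disj_set2E setICr.
    rewrite YB setIUr measureU//; last 3 first.
      + exact: measurableI.
      + by apply: measurableI => //; exact: measurableC.
      + by rewrite setIACA setICr setI0.
    have EBfin : P (E `&` B) \is a fin_num.
      by rewrite fin_num_measure//; exact: measurableI.
    move=> /(congr1 (fun x => x - P (E `&` B))%E).
    by rewrite ![(P (E `&` B) + _)%E]addeC !addeK.
  - have mB n : measurable (B n) by case: (LB n).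
    split; first exact: bigcupT_measurable.
    rewrite ge0_integral_bigcup//; last 2 first.
      + exact: measurable_funTS.
      + by move=> w _; rewrite lee_fin.
    rewrite setI_bigcupr measure_bigcup//=; last 2 first.
      + by move=> n _; exact: measurableI.
      + exact: trivIset_setIl.
    under [RHS]eq_eseriesl do rewrite in_setT.
    by apply: eq_eseriesr => n _; case: (LB n).
move=> _ [A FA [D FD <-]]; split; last exact: YE.
by apply: measurableI; [exact: s1.2|exact: s2.2].
Qed.

(** For [A] in [F2], [D] in [F3] and [Y] an [F3]-measurable version of P(E | F3),
    pulling out [Y] turns the integral of [Y] over [A `&` D] into that of
    [Y P(A | F3)] over [D]. The product formula says that the latter is
    P(E `&` A `&` D) for all [D]; one-sided prediction says this of the former. *)
Lemma cond_indepP F1 F2 F3 :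
  F1 `<=` measurable -> sub_sigma F2 -> sub_sigma F3 ->
  cond_indep P F1 F2 F3 <->
  forall E, F1 E -> exists Y, ge0_version F3 (join_sigma F2 F3) E Y.
Proof.
move=> m1 s2 s3; split => [ci E FE|ci E1 E2 FE1 FE2].
  have mE := m1 _ FE.
  have [Z1 [Z10 vZ1 _]] := cond_prob_exists P s3 mE.
  have mZ1 : measurable_wrt F3 Z1 by case: vZ1.
  exists Z1; apply: ge0_version_join => // A D FA FD.
  have mA : measurable A by exact: s2.2.
  have mD : measurable D by exact: s3.2.
  (* The versions Y1 and Y2 in the hypothesis agree almost surely with Z1 and Z2,
     for which the pull-out rule is available. *)
  have [Z2 [Z20 vZ2 pull]] := cond_prob_exists P s3 mA.
  have [Y1 [Y2 [Y12 [vY1 vY2 vY12 YE]]]] := ci _ _ FE FA.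
  rewrite [A `&` D]setIC -pull//.
  have ae_version B Y Y' : cond_prob_version P F3 B Y ->
      cond_prob_version P F3 B Y' -> {ae P, forall w, Y w = Y' w}.
    move=> [mY Yi YB] [mY' Y'i Y'B]; apply: (eq_integral_ae s3) => //.
    by move=> C FC; rewrite YB// Y'B.
  have [mY12 Y12i Y12E] := vY12.
  transitivity (\int[P]_(w in D) (Y12 w)%:E)%E.
    apply: ae_eq_integral => //.
    - apply/measurable_funTS/measurable_EFinP/measurable_funM.
      + exact: (measurable_wrt_fun s3.2 mZ1).
      + by case: vZ2 => mZ2 _ _; exact: (measurable_wrt_fun s3.2 mZ2).
    - exact/measurable_funTS/measurable_EFinP/(measurable_wrt_fun s3.2 mY12).
    - have := ae_version _ _ _ vZ2 vY2; have := ae_version _ _ _ vZ1 vY1.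
      by apply: filterS3 YE => w -> -> -> _.
  rewrite Y12E// integral_indic//; last by apply: measurableI.
  by rewrite [D `&` A]setIC setIA.
have mE1 := m1 _ FE1; have mE2 : measurable E2 by exact: s2.2.
have [Y vY] := ci _ FE1.
have [Z [Z0 vZ pull]] := cond_prob_exists P s3 mE2.
have [Y0 mY YE] := vY.
exists Y, Z, (Y \* Z); split => //.
- by apply: (ge0_version_cond_prob s3 _ mE1 vY) => //; exact: sub_joinr.
- apply: (@ge0_version_cond_prob _ F3) => //; first exact: measurableI.
  split => [w||C FC]; first by rewrite mulr_ge0.
  + have [saF3 _] := s3; apply/(measurable_wrtP _ saF3).
    by apply: measurable_funM; apply/measurable_wrtP => //; case: vZ.
  + rewrite pull// YE; first by rewrite [C `&` _]setIC setIA.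
    exact: (sub_sigmaI (sub_sigma_join s2 s3) (sub_joinr FC) (sub_joinl FE2)).
- by apply: aeW.
Qed.

End ConditionalIndependence.

(** * Graphoid properties *)

Section Graphoid.
Context {d : measure_display} {Omega : measurableType d} {R : realType}.
Variable P : probability Omega R.
Implicit Types (F G W : set_system Omega).

Lemma cond_indep_sym F1 F2 F3 : cond_indep P F1 F2 F3 -> cond_indep P F2 F1 F3.
Proof.
move=> ci E2 E1 FE2 FE1; have [Y1 [Y2 [Y12 [v1 v2 v12 Y12E]]]] := ci _ _ FE1 FE2.
exists Y2, Y1, Y12; split => //; first by rewrite setIC.
by apply: filterS Y12E => w ->; rewrite mulrC.
Qed.

Lemma cond_indep_sub F1 F2 F3 : F1 `<=` measurable -> sub_sigma F2 ->
  sub_sigma F3 -> F2 `<=` F3 -> cond_indep P F1 F2 F3.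
Proof.
move=> m1 s2 s3 F23; apply/cond_indepP => // E FE; have mE := m1 _ FE.
rewrite join_sigma_absorb//; last exact: s3.1.
have [Z [Z0 [mZ _ ZE] _]] := cond_prob_exists P s3 mE.
exists Z; split => // C FC; rewrite ZE// integral_indic//; exact: s3.2.
Qed.

(** Decomposition and weak union at once: an [F3]-measurable prediction that is
    as good as the one from [F2] and [F3] is as good as any prediction from
    intermediate information. *)
Lemma cond_indep_weaken F1 F2 F3 F2' F3' : F1 `<=` measurable ->
  sub_sigma F2 -> sub_sigma F3 -> sub_sigma F2' -> sub_sigma F3' ->
  F2' `<=` join_sigma F2 F3 -> F3 `<=` F3' -> F3' `<=` join_sigma F2 F3 ->
  cond_indep P F1 F2 F3 -> cond_indep P F1 F2' F3'.
Proof.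
move=> m1 s2 s3 s2' s3' F2'J F33' F3'J /(cond_indepP _ m1 s2 s3) ci.
apply/cond_indepP => // E /ci[Y [Y0 mY YE]]; exists Y; split => //.
  exact: subset_trans mY F33'.
move=> C FC; apply: YE; move: C FC; apply: join_sigmaS => //.
exact: smallest_sigma_algebra.
Qed.

(** The sets that differ from a member of [W] only inside a null set form a
    sigma-algebra. *)
Lemma completion_approx W C : sub_sigma W -> completion P W C ->
  measurable C /\ exists C' N,
    [/\ W C', measurable N, P N = 0%E & C `\` N = C' `\` N].
Proof.
move=> sW.
pose L : set_system Omega := [set C | measurable C /\ exists C' N,
  [/\ W C', P.-negligible N & C `\` N = C' `\` N]].
(* [L] is phrased with negligible sets, which are stable under countable unions;
   only the final exceptional set is enlarged to a measurable one. *)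
suff WL : completion P W `<=` L.
  move=> /WL[mC [C' [N [WC' [M [mM PM NM]] CN]]]]; split => //.
  exists C', M; split => //.
  have trim A : A `\` M = A `\` N `\` M by rewrite setDDl (setUidr NM).
  by rewrite trim CN -trim.
apply: smallest_sub.
  split.
  - split; first exact: measurable0.
    exists set0, set0; split => //; last exact: negligible_set0.
    by have [[]] := sW.
  - move=> A [mA [A' [N [WA' nN AN]]]]; split; first by rewrite setTD; exact: measurableC.
    exists (setT `\` A'), N; split => //; first by have [[_ WD _] _] := sW; exact: WD.
    apply/seteqP; split => w /= [[_ nA] nNw]; split => //; split => // Aw.
      have : (A' `\` N) w by []. by rewrite -AN => -[].
    have : (A `\` N) w by []. by rewrite AN => -[].
  - move=> A LA; split; first by apply: bigcupT_measurable => n; case: (LA n).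
    have /choice[A' /choice[N AN]] : forall n, exists A', exists N,
        [/\ W A', P.-negligible N & A n `\` N = A' `\` N].
      by move=> n; case: (LA n).
    exists (\bigcup_n A' n), (\bigcup_n N n); split => //.
    + by have [[_ _ WU] _] := sW; apply: WU => n; case: (AN n).
    + by apply: negligible_bigcup => n; case: (AN n).
    + apply/seteqP; split => w /= [[n _ Aw] Nw]; split => //; exists n => //.
        have : (A n `\` N n) w by split => // Nn; apply: Nw; exists n.
        by have [_ _ ->] := AN n => -[].
      have : (A' n `\` N n) w by split => // Nn; apply: Nw; exists n.
      by have [_ _ <-] := AN n => -[].
rewrite subUset; split => [A WA|A [mA PA]].
  split; first exact: sW.2.
  by exists A, set0; split => //; exact: negligible_set0.
split => //; exists set0, A; split; first by have [[]] := sW.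
  by apply/negligibleP.
by rewrite setDv set0D.
Qed.

(** The two predictions of [E] given by the hypotheses agree almost surely with
    the conditional probability given all the information, so each is measurable
    for both completions, and separability makes it measurable for the
    completion of [W]. There it is identified with P(E | W), as both have the
    same integrals over the sets of that completion. *)
Lemma cond_indep_intersection F1 F2 F3 W : F1 `<=` measurable ->
  sub_sigma F2 -> sub_sigma F3 -> sub_sigma W ->
  measurably_separable P F2 F3 W ->
  cond_indep P F1 F2 (join_sigma F3 W) -> cond_indep P F1 F3 (join_sigma F2 W) ->
  cond_indep P F1 (join_sigma F2 F3) W.
Proof.
move=> m1 s2 s3 sW sep.
have s2W := sub_sigma_join s2 sW; have s3W := sub_sigma_join s3 sW.
have s23 := sub_sigma_join s2 s3; have sG := sub_sigma_join s23 sW.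
move=> /(cond_indepP _ m1 s2 s3W) ci2 /(cond_indepP _ m1 s3 s2W) ci3.
apply/cond_indepP => // E FE; have mE := m1 _ FE.
set G := join_sigma _ _ in sG *.
have G2 : join_sigma F2 (join_sigma F3 W) = G by rewrite /G join_sigmaA.
have G3 : join_sigma F3 (join_sigma F2 W) = G by rewrite /G join_sigmaA (join_sigmaC F3).
have [Y3 v3] := ci2 _ FE; have [Y2 v2] := ci3 _ FE.
rewrite G2 in v3; rewrite G3 in v2.
have W3G : join_sigma F3 W `<=` G by rewrite -G2; exact: sub_joinr.
have W2G : join_sigma F2 W `<=` G by rewrite -G3; exact: sub_joinr.
have GT := sub_sigmaT sG.
have i3 := ge0_version_integrable s3W GT mE v3.
have i2 := ge0_version_integrable s2W GT mE v2.
have [Y30 m3 Y3E] := v3; have [Y20 m2 Y2E] := v2.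
have Y23 : {ae P, forall w, Y2 w = Y3 w}.
  apply: (eq_integral_ae sG) => //.
  - exact: subset_trans m2 W2G.
  - exact: subset_trans m3 W3G.
  - by move=> C GC; rewrite Y2E// Y3E.
have sWc F : sub_sigma F -> sub_sigma (completion P F).
  move=> [_ FM]; apply: sub_sigma_gen; rewrite subUset; split => //.
  by move=> N [].
have Y2W : measurable_wrt (completion P W) Y2.
  move=> _ [B mB <-]; rewrite setTI -sep; split.
    by apply: sub_sigma_algebra; left; apply: m2; exists B => //; rewrite setTI.
  have [saC _] := sWc _ s3W.
  have mB2 : measurable (Y2 @^-1` B).
    by rewrite -[X in measurable X]setTI; exact: (measurable_wrt_fun s2W.2 m2).
  have mB3 : measurable (Y3 @^-1` B).
    by rewrite -[X in measurable X]setTI; exact: (measurable_wrt_fun s3W.2 m3).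
  have [N [mN PN sN]] := Y23.
  (* Up to the null set on which the two predictions differ, their preimages
     coincide. *)
  have -> : Y2 @^-1` B = (Y3 @^-1` B `\` N) `|` (Y2 @^-1` B `&` N).
    apply/seteqP; split => w.
      move=> Bw; have [Nw|Nw] := pselect (N w); [by right|left].
      split => //; rewrite /preimage /=.
      by have <- : Y2 w = Y3 w by apply: contrapT => /sN.
    move=> [[Bw Nw]|[]//]; rewrite /preimage /=.
    by have -> : Y2 w = Y3 w by apply: contrapT => /sN.
  have nullC M : measurable M -> M `<=` N -> completion P (join_sigma F3 W) M.
    move=> mM MN; apply: sub_sigma_algebra; right; split => //.
    exact: (subset_measure0 mM mN MN).
  have cN : completion P (join_sigma F3 W) N by exact: nullC.
  have cB : completion P (join_sigma F3 W) (Y3 @^-1` B).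
    by apply: sub_sigma_algebra; left; apply: m3; exists B => //; rewrite setTI.
  have cBN : completion P (join_sigma F3 W) (Y2 @^-1` B `&` N).
    by apply: nullC; [exact: measurableI|exact: subIsetr].
  move: cN cB cBN; rewrite -!(g_sigma_measurableE _ saC) => cN cB cBN.
  apply: (@measurableU _ (g_sigma_algebraType _)) => //.
  exact: (@measurableD _ (g_sigma_algebraType _)).
have WG : W `<=` G by exact: sub_joinr.
have [Z [Z0 vZ _]] := cond_prob_exists P sW mE.
have [mZ Zi ZE] := vZ.
have Y2Z : {ae P, forall w, Y2 w = Z w}.
  apply: (eq_integral_ae (sWc _ sW)) => //.
    move=> C /mZ WC; apply: sub_sigma_algebra; by left.
  move=> C /(completion_approx sW)[mC [C' [N [WC' mN PN CN]]]].
  have mC' := sW.2 _ WC'.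
  have trim (f : Omega -> R) D : (forall w, 0 <= f w) ->
      P.-integrable setT (EFin \o f) -> measurable D ->
      (\int[P]_(w in D) (f w)%:E = \int[P]_(w in D `\` N) (f w)%:E)%E.
    move=> f0 fi mD; apply: ge0_negligible_integral => //.
    - exact: measurable_funTS (measurable_int _ fi).
    - by move=> w _; rewrite lee_fin.
  rewrite trim// CN -trim// Y2E; last exact: WG.
  rewrite [RHS]trim// CN -trim// ZE// integral_indic//.
exists Z; split => // C GC; rewrite -Y2E//.
have mC := sG.2 _ GC.
apply: ae_eq_integral => //.
- exact: measurable_funTS (measurable_int _ Zi).
- exact: measurable_funTS (measurable_int _ i2).
- by apply: filterS Y2Z => w ->.
Qed.

End Graphoid.

(** * Granger noncausality of sets of components *)

Section Histories.
Context {d : measure_display} {Omega : measurableType d} {R : realType}.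
Context {P : probability Omega R} {V : finType}.
Variable X : int -> V -> {RV P >-> R}.
Implicit Types (A B S : {set V}) (s t : int).

Lemma sub_sigma_hist A t : sub_sigma (hist X A t).
Proof.
apply: sub_sigma_gen => E [s [a [_ _ [B mB <-]]]].
exact: measurable_funP.
Qed.

Lemma hist_measurable A t : hist X A t `<=` measurable.
Proof. exact: (sub_sigma_hist A t).2. Qed.

Lemma hist_sub A B s t : A \subset B -> s <= t -> hist X A s `<=` hist X B t.
Proof.
move=> /fintype.subsetP AB st; apply: sub_sigma_algebra2 => E [r [a [rs aA EE]]].
by exists r, a; split => //; [exact: le_trans st|exact: AB].
Qed.

Lemma histU A B t :
  hist X (A :|: B)%SET t = join_sigma (hist X A t) (hist X B t).
Proof.
apply/seteqP; split; last first.
  apply: join_sigmaS; first exact: smallest_sigma_algebra.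
    by apply: hist_sub => //; exact: finset.subsetUl.
  by apply: hist_sub => //; exact: finset.subsetUr.
apply: smallest_sub; first exact: smallest_sigma_algebra.
move=> E [s [a [st + EE]]]; rewrite inE => /orP[aA|aB].
  by apply: sub_joinl; apply: sub_sigma_algebra; exists s, a.
by apply: sub_joinr; apply: sub_sigma_algebra; exists s, a.
Qed.

Lemma noncausal_subl A A' B :
  A' \subset A -> noncausal X A B -> noncausal X A' B.
Proof.
move=> A'A nc t.
have cover S : hist X S t `<=` join_sigma (hist X A t) (hist X (~: A)%SET t).
  by rewrite -histU finset.setUCr; apply: hist_sub => //; exact: finset.subsetT.
apply: cond_indep_weaken (nc t) => //; try exact: sub_sigma_hist.
- exact: hist_measurable.
- by apply: hist_sub => //; rewrite finset.setCS.
Qed.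

Lemma noncausal0 B : noncausal X finset.set0 B.
Proof.
move=> t; apply: cond_indep_sub; try exact: sub_sigma_hist.
  exact: hist_measurable.
by apply: hist_sub => //; exact: finset.sub0set.
Qed.

(** The conditioning sigma-algebra of [contemp_indep]. *)
Definition contemp_base A B t : set_system Omega :=
  join_sigma (hist X [set: V]%SET t) (hist X (~: (A :|: B))%SET (t + 1)).

Lemma sub_sigma_base A B t : sub_sigma (contemp_base A B t).
Proof. by apply: sub_sigma_join; exact: sub_sigma_hist. Qed.

Lemma contemp_indep_sym A B : contemp_indep X A B -> contemp_indep X B A.
Proof. by move=> ci t; rewrite finset.setUC; exact/cond_indep_sym/ci. Qed.

Lemma contemp_indep_subl A A' B :
  A' \subset A -> contemp_indep X A B -> contemp_indep X A' B.
Proof.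
move=> A'A /contemp_indep_sym ci; apply: contemp_indep_sym => t.
have base (S : {set V}) : ~: (S :|: B)%SET \subset (A :|: ~: (B :|: A))%SET ->
    join_sigma (hist X [set: V]%SET t) (hist X (~: (B :|: S))%SET (t + 1)) `<=`
    join_sigma (hist X A (t + 1)) (contemp_base B A t).
  move=> sub; rewrite /contemp_base join_sigmaA (join_sigmaC (hist X A _)) -join_sigmaA -histU.
  by apply: join_sigma_mono => //; apply: hist_sub => //; rewrite finset.setUC.
apply: cond_indep_weaken (ci t) => //.
- exact: hist_measurable.
- exact: sub_sigma_hist.
- exact: sub_sigma_base.
- exact: sub_sigma_hist.
- exact: sub_sigma_base.
- by move=> E EA; apply: sub_joinl; exact: hist_sub EA.
- apply: join_sigma_mono => //; apply: hist_sub => //.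
  by rewrite finset.setCS; exact: finset.setUS.
- apply: base; apply/fintype.subsetP => v; rewrite !inE negb_or.
  by case: (v \in A) => //=; case: (v \in B); rewrite ?andbF.
Qed.

Lemma contemp_indep0 B : contemp_indep X finset.set0 B.
Proof.
apply: contemp_indep_sym => t; apply: cond_indep_sub.
- exact: hist_measurable.
- exact: sub_sigma_hist.
- exact: sub_sigma_base.
- move=> E E0; apply: sub_joinr.
  by apply: hist_sub E0 => //; exact: finset.sub0set.
Qed.

Hypothesis hsep : separability_condition X.

(** In the assumption on the process the two index sets overlap exactly in the
    conditioning set; adjoining [S] to each of [A] and [B] brings disjoint sets
    to that form, and the conditioning absorbs it again. *)
Lemma separable_hist A B S C (k : nat) t : [disjoint A & B]%B -> (0 < k)%N ->
  measurably_separable P (hist X A t) (hist X B t)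
    (join_sigma (hist X S t) (hist X C (t - k%:Z))).
Proof.
move=> dAB k0.
have := @hsep (A :|: S)%SET (B :|: S)%SET C k t k0.
have -> : ((A :|: S) :&: (B :|: S))%SET = S.
  by rewrite -finset.setUIl (eqP (_ : (A :&: B)%SET == finset.set0)) ?set0U//
    ?finset.set0U// setI_eq0.
suff absorb D : join_sigma (hist X (D :|: S)%SET t)
      (join_sigma (hist X S t) (hist X C (t - k%:Z))) =
    join_sigma (hist X D t) (join_sigma (hist X S t) (hist X C (t - k%:Z))).
  by rewrite /measurably_separable !absorb.
by rewrite !join_sigmaA -!histU -finset.setUA finset.setUid.
Qed.

(** Intersection with the history of all remaining components as conditioning;
    the lagged term in the separability condition is taken for the empty set of
    components, so that it adds nothing. *)
Lemma noncausalU A A' B : [disjoint A & A']%B ->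
  noncausal X A B -> noncausal X A' B -> noncausal X (A :|: A')%SET B.
Proof.
move=> dAA' nc nc' t.
set S := (~: (A :|: A'))%SET.
have CA : (~: A = A' :|: S)%SET.
  apply/setP => v; rewrite !inE negb_or.
  by have := disjointFr dAA' (x := v); case: (v \in A) => [->|_] //=; case: (v \in A').
have CA' : (~: A' = A :|: S)%SET.
  apply/setP => v; rewrite !inE negb_or.
  by have := disjointFl dAA' (x := v); case: (v \in A') => [->|_] //=; case: (v \in A).
rewrite histU; apply: cond_indep_intersection; try exact: sub_sigma_hist.
- exact: hist_measurable.
- have := separable_hist S finset.set0 t dAA' (isT : (0 < 1)%N).
  rewrite join_sigmaC join_sigma_absorb//; first exact: (sub_sigma_hist _ _).1.
  by apply: hist_sub; [exact: finset.sub0set|rewrite gerBl].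
- by rewrite -histU -CA.
- by rewrite -histU -CA'.
Qed.

(** Intersection with the full past and the present of all remaining components
    as conditioning; the full past is the lagged term of the separability
    condition at lag one. *)
Lemma contemp_indepU A A' B : [disjoint A & A']%B ->
  [disjoint A & B]%B -> [disjoint A' & B]%B ->
  contemp_indep X A B -> contemp_indep X A' B ->
  contemp_indep X (A :|: A')%SET B.
Proof.
move=> dAA' dAB dA'B /contemp_indep_sym ci /contemp_indep_sym ci'.
apply: contemp_indep_sym => t.
set S := (~: (B :|: (A :|: A')))%SET.
have CA : (~: (B :|: A) = A' :|: S)%SET.
  apply/setP => v; rewrite !inE !negb_or.
  have := disjointFr dAA' (x := v); have := disjointFr dA'B (x := v).
  by case: (v \in A) => [_ ->|+ _] //=; rewrite ?andbF//; case: (v \in A') => [->|].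
have CA' : (~: (B :|: A') = A :|: S)%SET.
  apply/setP => v; rewrite !inE !negb_or.
  have := disjointFl dAA' (x := v); have := disjointFr dAB (x := v).
  by case: (v \in A') => [_ ->|+ _] //=; rewrite ?andbF//; case: (v \in A) => [->|].
have base D : join_sigma (hist X [set: V]%SET t) (hist X (D :|: S)%SET (t + 1)) =
    join_sigma (hist X D (t + 1))
      (join_sigma (hist X [set: V]%SET t) (hist X S (t + 1))).
  by rewrite join_sigmaA (join_sigmaC (hist X D _)) -join_sigmaA -histU.
rewrite histU; apply: cond_indep_intersection; try exact: sub_sigma_hist.
- exact: hist_measurable.
- by apply: sub_sigma_join; exact: sub_sigma_hist.
- have := separable_hist S [set: V]%SET (t + 1) dAA' (isT : (0 < 1)%N).
  by rewrite addrK join_sigmaC.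
- by rewrite -base -CA; exact: ci.
- by rewrite -base -CA'; exact: ci'.
Qed.

Lemma noncausal_pointwise A B :
  (forall a, a \in A -> noncausal X [set a]%SET B) -> noncausal X A B.
Proof.
elim: {A}#|A| {-2}A (erefl #|A|) => [A /eqP|n IH A cA ncA].
  by rewrite cards_eq0 => /eqP -> _; exact: noncausal0.
have /card_gt0P[a aA] : (0 < #|A|)%N by rewrite cA.
rewrite -(finset.setD1K aA); apply: noncausalU.
- by rewrite disjoints1 !inE eqxx.
- exact: ncA.
- apply: IH => [|b]; first by move: cA; rewrite (cardsD1 a) aA => -[].
  by rewrite inE => /andP[_]; exact: ncA.
Qed.

Lemma contemp_indep_pointwise A B : [disjoint A & B]%B ->
  (forall a, a \in A -> contemp_indep X [set a]%SET B) -> contemp_indep X A B.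
Proof.
elim: {A}#|A| {-2}A (erefl #|A|) => [A /eqP|n IH A cA dAB ciA].
  by rewrite cards_eq0 => /eqP -> _ _; exact: contemp_indep0.
have /card_gt0P[a aA] : (0 < #|A|)%N by rewrite cA.
have dAaB : [disjoint A :\ a & B]%B.
  by apply: disjointWl dAB; exact: subD1set.
rewrite -(finset.setD1K aA); apply: contemp_indepU => //.
- by rewrite disjoints1 !inE eqxx.
- by rewrite disjoints1 (disjointFr dAB aA).
- exact: ciA.
- apply: IH => // [|b]; first by move: cA; rewrite (cardsD1 a) aA => -[].
  by rewrite inE => /andP[_]; exact: ciA.
Qed.

(** By symmetry the sets can be decomposed into points on either side. *)
Lemma contemp_indep_pairwise A B : [disjoint A & B]%B ->
  (forall a b, a \in A -> b \in B -> contemp_indep X [set a]%SET [set b]%SET) ->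
  contemp_indep X A B.
Proof.
move=> dAB ci; apply: contemp_indep_pointwise => // a aA.
apply: contemp_indep_sym; apply: contemp_indep_pointwise => [|b bB].
  by rewrite disjoint_sym disjoints1 (disjointFr dAB aA).
by apply: contemp_indep_sym; exact: ci.
Qed.

End Histories.

(** * Markov properties *)

Section MarkovProperties.
Context {d : measure_display} {Omega : measurableType d} {R : realType}.
Context {P : probability Omega R} {V : finType}.
Variables (X : int -> V -> {RV P >-> R}) (G : mixed_graph V).

Lemma paS1 a : paS G [set a]%SET = pa G a.
Proof.
rewrite /paS finset.big_set1; apply/setP => v; rewrite !inE.
by case: eqVneq => // ->; rewrite dedge_irr.
Qed.

Lemma neS1 a : neS G [set a]%SET = ne G a.
Proof.
rewrite /neS finset.big_set1; apply/setP => v; rewrite !inE.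
by case: eqVneq => // ->; rewrite uedge_irr.
Qed.

Lemma BC_LC : BC X G -> LC X G.
Proof. by move=> bc a; have := bc [set a]%SET; rewrite paS1 neS1. Qed.

Lemma LC_PC : LC X G -> PC X G.
Proof.
move=> lc a b ab; split => nab; have [nc ci] := lc b.
  by apply: noncausal_subl nc; rewrite finset.sub1set !inE negb_or nab.
by apply: contemp_indep_subl ci; rewrite finset.sub1set !inE negb_or nab.
Qed.

Hypothesis hsep : separability_condition X.

Lemma PC_LC : PC X G -> LC X G.
Proof.
move=> pc b; split.
  apply: noncausal_pointwise => // a; rewrite !inE negb_or => /andP[nab ab].
  by have [] := pc a b ab; move=> /(_ nab).
apply: contemp_indep_pointwise => // [|a].
  by rewrite disjoint_sym disjoints1 !inE eqxx orbT.
rewrite !inE negb_or => /andP[nab ab].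
by have [_ /(_ nab)] := pc a b ab.
Qed.

(** The edges missing around [A] are missing at each of its vertices. The
    noncausal half needs the composition property to assemble the targets, the
    contemporaneous half is assembled from pairs. *)
Lemma LC_BC : composition_property X -> LC X G -> BC X G.
Proof.
move=> comp lc A; split.
  apply/comp => [|b bA].
    by rewrite disjoint_sym finset.disjoints_subset finset.setCK finset.subsetUr.
  have [nc _] := lc b; apply: noncausal_subl nc; rewrite finset.setCS.
  apply/fintype.subsetP => v; rewrite !inE => /orP[vb|/eqP ->]; last by rewrite bA orbT.
  case: (boolP (v \in A)) => [|vA]; rewrite ?orbT// orbF /=.
  by apply/bigcupP; exists b => //; rewrite inE.
apply: contemp_indep_pairwise => // [|a b].
  by rewrite disjoint_sym finset.disjoints_subset finset.setCK finset.subsetUr.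
rewrite !inE negb_or negb_and negbK => /andP[/orP[aA /negP//|na] naA] bA.
have ab : a != b by apply: contraNneq naA => ->.
have [_ ci] := LC_PC lc ab; apply: ci.
apply: contraNN na => uab; apply/bigcupP; exists b => //.
by rewrite inE.
Qed.

End MarkovProperties.

Theorem theorem2p5 (R : realType) (d : measure_display)
    (Omega : measurableType d) (P : probability Omega R) (V : finType)
    (X : int -> V -> {RV P >-> R}) (G : mixed_graph V)
    (hstat : stationary X) (hsep : separability_condition X) :
  [/\ BC X G -> LC X G,
      LC X G <-> PC X G
    & composition_property X -> (BC X G <-> LC X G) /\ (LC X G <-> PC X G)].
Proof.
have LCPC : LC X G <-> PC X G by split; [exact: LC_PC|exact: PC_LC].
split => [||comp]; [exact: BC_LC|exact: LCPC|split=> //].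
by split; [exact: BC_LC|exact: LC_BC].
Qed.
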